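(* There exist absolute constants $c>0$ and $C>0$ such that the following holds. Let $p$ be a prime and let $f\in\mathbb{F}_p[X,Y]$ be a bivariate quadratic polynomial (i.e. of degree two) that is not of the form $f(x,y)=g(ax+by)$ for some univariate polynomial $g$ (and constants $a,b$). Then for every $A\subset\mathbb{F}_p$ of size $|A|\le\sqrt{p}$ we have $$|A+A|+|f(A)|\ \ge\ C\,|A|^{1+c}.$$
   Context: $A+A=\{a+b: a,b\in A\}$. For a bivariate polynomial $f$, $f(A)=f(A,A)=\{f(a,b): a,b\in A\}$. *)

(* Defs.v *)
From HB Require Import structures.
From mathcomp Require Import all_boot all_algebra.
From mathcomp Require Import mpoly.

(* The bivariate-polynomial definitions are kept in a file of their own so
   that the notations of mpoly never meet those of MathComp-Analysis; a file
   using both should Require mpoly without importing it. *)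

Set Implicit Arguments.
Unset Strict Implicit.
Unset Printing Implicit Defensive.

Import GRing.Theory.
Local Open Scope ring_scope.

Section BivariatePolynomials.

Variable F : finFieldType.

Definition bipoly := {mpoly F[2]}.

Implicit Types (f : bipoly) (A : {set F}).

Definition bieval f (x y : F) : F := f.@[tnth [tuple x; y]].

(* [msize] is one more than the total degree (and 0 for the zero polynomial). *)
Definition quadratic f : Prop := msize f = 3%N.

(* An identity of polynomials, not of functions: [g] is pushed to F[X, Y]
   coefficientwise and evaluated there at the linear form a X + b Y. *)
Definition univariate_in_linear_form f : Prop :=
  exists (g : {poly F}) (a b : F),
    f = (map_poly (@mpolyC 2 F) g).[a *: 'X_ord0 + b *: 'X_ord_max].

Definition sumset A : {set F} := [set a + b | a in A, b in A].

Definition poly_image f A : {set F} := [set bieval f a b | a in A, b in A].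

End BivariatePolynomials.

(* Main.v *)
Require Import Defs.
From mathcomp Require Import all_boot all_order all_algebra.
From mathcomp Require Import reals exp.
From mathcomp Require Import zify ring.
From mathcomp Require mpoly.

Set Implicit Arguments.
Unset Strict Implicit.
Unset Printing Implicit Defensive.

Import GRing.Theory Num.Theory.
Local Open Scope ring_scope.

(** Let [K > 1] be an integer with [|A + A| <= K |A|] and [|f(A)| <= K |A|].
    The proof derives [|A| <= K ^ 474] from [|A|^2 <= p]; since [K] can be
    taken of the order of [(|A + A| + |f(A)|) / |A|], this gives the theorem
    with [c = 1 / 474].

    Call [c] a dilator of [A] if [|A + c A| <= K^n |A|] for a bounded [n].
    By Plunnecke's inequality and Ruzsa's triangle inequality, sums, products,
    opposites and inverses of dilators are again dilators, at the price of a
    larger [n].  On the other hand, averaging the additive energy of [A] and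
    [c A] over [c] shows that the dilators cannot be much more numerous than
    [|A|].  If there is a set [B] of dilators almost as large as [A], consider
    the quotients [(b1 - b2) / (b3 - b4)] of elements of [B].  Either they fill
    the whole field, which has at least [|A|^2] elements, or some quotient [r]
    is such that [r + 1] is not a quotient; then the sums [b + (r + 1) b'] are
    pairwise distinct and form a set of [|B|^2] dilators.  In both cases there
    are about [|A|^2] dilators, so [|A|] is at most a power of [K]
    (lemma [card_bound_of_dilators]).

    It remains to find many dilators.  As [f(A)] is small, [f(x, y) = f(x', y')]
    has at least [|A|^3 / K] solutions in [A].  Sort them by the differences
    [d = x - x'] and [e = y - y'], which lie in the small set [A - A].  For
    given [(d, e)] the equation is linear in [x, y], because [f] is quadratic.
    Hence for many [(d, e)] a line [l x + m y = c] has many points in [A * A],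
    and then [m / l] is a dilator (lemma [dilator_line]).  If the quadratic part
    of [f] is nondegenerate, [m / l] is a homography in [d / e], and many
    dilators arise (lemma [nondegenerate_bound]).

    Otherwise, up to exchanging the variables, [f(x, y) = h(x + ka y) + et y]
    with [h] quadratic, and [et <> 0] because [f] is not a function of
    a single linear form.  All the lines above have the same slope, so only [ka] is shown
    to be a dilator, but then [x + ka y] takes few values.  The popular ones
    form a set [U] that is additively close to [A], and so is [h(U)], because
    [h(u) + et y] lies in [f(A)] for many [y].  Finally [h(u + d) - h(u)] is an
    affine function of [u] with leading coefficient proportional to [d], so the
    popular differences [d] of [U] are proportional to dilators
    (lemmas [parabola_bound] and [degenerate_bound]). *)

(** * Double counting *)

Section DoubleCounting.

Variables (T I : finType) (pi : T -> I).
Implicit Types (Q : {set T}) (J : {set I}).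
Local Open Scope nat_scope.

Definition fiber Q i := [set q in Q | pi q == i].

Lemma card_sum_fibers Q J :
  {in Q, forall q, pi q \in J} -> #|Q| = \sum_(i in J) #|fiber Q i|.
Proof.
move=> QJ; rewrite -sum1_card (partition_big pi (mem J)) //=.
apply: eq_bigr => i _; rewrite -sum1_card; apply: eq_bigl => q.
by rewrite inE.
Qed.

Lemma card_le_fibers Q J r :
    {in Q, forall q, pi q \in J} -> {in J, forall i, #|fiber Q i| <= r} ->
  #|Q| <= #|J| * r.
Proof.
move=> QJ le_r; rewrite (card_sum_fibers QJ) -sum_nat_const.
exact: leq_sum.
Qed.

Lemma card_ge_fibers Q J r :
  {in J, forall i, r <= #|fiber Q i|} -> #|J| * r <= #|Q|.
Proof.
move=> le_r; pose Q' := [set q in Q | pi q \in J].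
apply: (@leq_trans #|Q'|); last by apply/subset_leq_card/subsetP=> q /setIdP[].
rewrite (@card_sum_fibers Q' J) => [|q]; last by rewrite inE => /andP[].
rewrite -sum_nat_const; apply: leq_sum => i Ji.
apply: leq_trans (le_r i Ji) (subset_leq_card _).
by apply/subsetP=> q; rewrite !inE => /andP[-> /eqP->]; rewrite Ji eqxx.
Qed.

(** The fibers with at most [t] elements cover at most [#|J| * t] points, so the
    larger fibers must cover the rest. *)
Lemma card_popular_fibers Q J t M :
    {in Q, forall q, pi q \in J} -> {in J, forall i, #|fiber Q i| <= M} ->
  #|Q| <= #|J| * t + M * #|[set i in J | t < #|fiber Q i|]|.
Proof.
move=> QJ le_M; rewrite (card_sum_fibers QJ).
rewrite (bigID (fun i => t < #|fiber Q i|)) /= addnC; apply: leq_add.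
  apply: (@leq_trans (\sum_(i in J) t)); last by rewrite sum_nat_const.
  rewrite [leqRHS](bigID (fun i => t < #|fiber Q i|)) /= [leqRHS]addnC.
  apply: (leq_trans _ (leq_addr _ _)).
  by apply: leq_sum => i /andP[_]; rewrite -leqNgt.
rewrite mulnC -sum_nat_const.
rewrite [leqRHS](eq_bigl (fun i => (i \in J) && (t < #|fiber Q i|))).
  by apply: leq_sum => i /andP[/le_M].
by move=> i; rewrite inE.
Qed.

(** Cauchy-Schwarz applied to the cardinals of the fibers: the double sum counts
    the pairs of points with the same image. *)
Lemma sqr_card_collisions Q :
  #|Q| ^ 2 <= #|pi @: Q| * \sum_(q in Q) \sum_(r in Q) (pi q == pi r).
Proof.
set J := pi @: Q.
have QJ : {in Q, forall q, pi q \in J} by move=> q Qq; apply: imset_f.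
pose m i := #|fiber Q i|.
have mE i : m i = \sum_(q in Q) (pi q == i).
  rewrite /m -sum1_card [LHS](eq_bigl (fun q => (q \in Q) && (pi q == i))).
    by rewrite big_mkcondr.
  by move=> q; rewrite inE.
have -> : \sum_(q in Q) \sum_(r in Q) (pi q == pi r) = \sum_(i in J) m i ^ 2.
  transitivity (\sum_(i in J) \sum_(q in Q) \sum_(r in Q)
                  (pi q == i) * (pi r == i)).
    rewrite [RHS]exchange_big; apply: eq_bigr => q Qq /=.
    rewrite [RHS]exchange_big; apply: eq_bigr => r Qr /=.
    rewrite (bigD1 (pi q)) ?QJ //= eqxx mul1n eq_sym big1 ?addn0 //.
    by move=> i /andP[_ /negPf]; rewrite eq_sym => ->.
  apply: eq_bigr => i _; rewrite expnS expn1 mE big_distrlr /=.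
  by [].
rewrite (card_sum_fibers QJ) -/m.
rewrite -(@leq_pmul2l 2) // expnS expn1 big_distrlr /= !big_distrr /=.
apply: (@leq_trans (\sum_(i in J) \sum_(j in J) (m i ^ 2 + m j ^ 2))).
  apply: leq_sum => i _; rewrite big_distrr /=; apply: leq_sum => j _.
  exact: nat_Cauchy.
apply: eq_leq.
under eq_bigr do rewrite big_split /= sum_nat_const.
rewrite big_split /= sum_nat_const -!big_distrr /= -mulnDr.
nia.
Qed.

End DoubleCounting.

Lemma sum_eq_le1 (T : finType) (S : {set T}) (x : T) :
  (\sum_(y in S) (y == x) <= 1)%N.
Proof.
rewrite (_ : (\sum_(y in S) (y == x))%N = #|[set y in S | y == x]|).
  rewrite -(cards1 x) subset_leq_card //.
  by apply/subsetP=> y /setIdP[_ /eqP->]; rewrite set11.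
rewrite -sum1_card [RHS](eq_bigl (fun y => (y \in S) && (y == x))).
  by rewrite big_mkcondr.
by move=> y; rewrite inE.
Qed.

(** * Sumsets *)

Section Sumsets.

Variable V : finZmodType.
Implicit Types (X Y Z B C : {set V}).

Definition addS X Y := [set x + y | x in X, y in Y].
Definition oppS X := [set - x | x in X].
Local Notation "X <+> Y" := (addS X Y) (at level 50, left associativity).

Lemma mem_addS X Y x y : x \in X -> y \in Y -> x + y \in X <+> Y.
Proof. by move=> Xx Yy; apply/imset2P; exists x y. Qed.

Lemma addSC X Y : X <+> Y = Y <+> X.
Proof.
by apply/setP=> z; apply/imset2P/imset2P=> -[x y Xx Yy ->]; exists y x;
  rewrite // addrC.
Qed.

Lemma addSA X Y Z : X <+> (Y <+> Z) = X <+> Y <+> Z.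
Proof.
apply/setP=> z; apply/imset2P/imset2P=> [[x _ Xx /imset2P[y w Yy Zw ->] ->]|].
  by exists (x + y) w; rewrite ?mem_addS ?addrA.
move=> [_ w /imset2P[x y Xx Yy ->] Zw ->].
by exists x (y + w); rewrite ?mem_addS ?addrA.
Qed.

Lemma addSS X X' Y Y' :
  X \subset X' -> Y \subset Y' -> X <+> Y \subset X' <+> Y'.
Proof.
move=> /subsetP sX /subsetP sY; apply/subsetP=> _ /imset2P[x y Xx Yy ->].
by rewrite mem_addS ?sX ?sY.
Qed.

Lemma card_addS1 X c : #|X <+> [set c]| = #|X|.
Proof.
have -> : X <+> [set c] = [set x + c | x in X].
  apply/setP=> z; apply/imset2P/imsetP=> [[x _ Xx /set1P-> ->]|[x Xx ->]].
    by exists x.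
  by exists x c; rewrite ?set11.
exact/card_imset/addIr.
Qed.

Lemma card_addSl X Y y : y \in Y -> (#|X| <= #|X <+> Y|)%N.
Proof.
by move=> Yy; rewrite -(card_addS1 X y) subset_leq_card // addSS ?sub1set.
Qed.

Lemma addS0 X : X <+> set0 = set0.
Proof.
by apply/setP=> z; rewrite inE; apply/negP=> /imset2P[x y _]; rewrite inE.
Qed.

Lemma addSU X Y Z : X <+> (Y :|: Z) = (X <+> Y) :|: (X <+> Z).
Proof.
apply/setP=> w; rewrite inE; apply/imset2P/orP.
  by move=> [x y Xx /setUP[]Hy ->]; [left|right]; rewrite mem_addS.
by case=> /imset2P[x y Xx Hy ->]; exists x y; rewrite // inE Hy ?orbT.
Qed.

(** Fix a decomposition [s = y + z] for every [s] in [Y <+> Z].  Then [(s, x)]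
    is determined by [y + x] and [z - x], since their sum is [s]. *)
Lemma Ruzsa_triangle X Y Z :
  (#|X| * #|Y <+> Z| <= #|Y <+> X| * #|Z <+> oppS X|)%N.
Proof.
rewrite [leqLHS]mulnC -!cardsX.
pose good (s : V) (yz : V * V) :=
  [&& yz.1 \in Y, yz.2 \in Z & s == yz.1 + yz.2].
pose rep (s : V) := odflt (0, 0) [pick yz | good s yz].
have repE s : s \in Y <+> Z ->
    [/\ (rep s).1 \in Y, (rep s).2 \in Z & s = (rep s).1 + (rep s).2].
  case/imset2P=> y z Yy Zz sE; rewrite /rep; case: pickP => [yz|/(_ (y, z))].
    by case/and3P=> Yy' Zz' /eqP.
  by rewrite /good /= Yy Zz sE eqxx.
pose h sx : V * V := ((rep sx.1).1 + sx.2, (rep sx.1).2 - sx.2).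
rewrite -(@card_in_imset _ _ h (setX (Y <+> Z) X)) => [|[s x] [t y]].
  apply/subset_leq_card/subsetP=> _ /imsetP[[s x] /setXP[/repE[Y1 Z2 _] Xx] ->].
  by rewrite inE /= !mem_addS ?imset_f.
move=> /setXP[/= /repE[_ _ sE] _] /setXP[/= /repE[_ _ tE] _] [/= e1 e2].
have est : s = t.
  have -> : s = ((rep s).1 + x) + ((rep s).2 - x).
    by rewrite addrACA subrr addr0.
  by rewrite e1 e2 addrACA subrr addr0.
by move: e1; rewrite est => /addrI->.
Qed.

(** By induction on [C].  When [c] is added, [W] collects the [x] for which
    [x + c] is already in [X <+> C']: exactly [#|X| - #|W|] points are added to
    [X <+> C'], while at most [#|X <+> B| - #|W <+> B|] are added to
    [X <+> B <+> C'].  The hypothesis, applied to [W], compares the two. *)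
Lemma Petridis X B C :
    (forall Z, Z \subset X -> #|X <+> B| * #|Z| <= #|Z <+> B| * #|X|)%N ->
  (#|X| * #|X <+> B <+> C| <= #|X <+> B| * #|X <+> C|)%N.
Proof.
move=> minX; elim: {C}#|C| {-2}C (erefl #|C|) => [|n IHn] C.
  by move/cards0_eq->; rewrite !addS0 cards0 !muln0.
move=> Cn; have /card_gt0P[c Cc] : (0 < #|C|)%N by rewrite Cn.
have {Cn} C'n : #|C :\ c| = n by move: Cn; rewrite (cardsD1 c) Cc => -[].
rewrite -(setD1K Cc) setUC !addSU; move: (C :\ c) {Cc} C'n => C' /IHn {}IHn.
pose W := [set x in X | x + c \in X <+> C'].
have sWX : W \subset X by apply/subsetP=> x /setIdP[].
have sW1 : W <+> [set c] \subset X <+> C'.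
  by apply/subsetP=> _ /imset2P[x _ /setIdP[_ XCx] /set1P-> ->].
have XBE : (#|X <+> B <+> C' :|: (X <+> B <+> [set c])| <=
    #|X <+> B <+> C'| + (#|X <+> B| - #|W <+> B|))%N.
  have sWB : W <+> B <+> [set c] \subset X <+> B <+> C'.
    rewrite -!addSA [B <+> _]addSC [B <+> C']addSC !addSA.
    exact: addSS.
  rewrite -(card_addS1 (X <+> B) c) -(card_addS1 (W <+> B) c).
  rewrite -cardsDS ?addSS //.
  apply: leq_trans (leq_card_setU _ _); apply/subset_leq_card/subsetP=> z.
  rewrite !inE; case: (boolP (z \in W <+> B <+> _)) => //= WBz.
  by rewrite (subsetP sWB).
have XE : (#|X <+> C' :|: (X <+> [set c])| = #|X <+> C'| + (#|X| - #|W|))%N.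
  rewrite -(card_addS1 X c) -(card_addS1 W c) -cardsDS ?addSS //.
  rewrite cardsDS ?addSS // cardsU addnBA ?subset_leq_card ?addSS //.
  congr (_ - #|pred_of_set _|)%N.
  apply/eqP; rewrite eqEsubset subsetI sW1 addSS // !andbT.
  apply/subsetP=> z /setIP[XCz /imset2P[x _ Xx /set1P-> zE]].
  by rewrite zE mem_addS ?set11 // inE Xx -zE.
rewrite XE mulnDr (leq_trans (leq_mul (leqnn _) XBE)) // mulnDr leq_add //.
rewrite !mulnBr (mulnC #|X| #|X <+> B|) (mulnC #|X| #|W <+> B|).
exact/leq_sub2l/minX.
Qed.

(** A subset with the least quotient [#|Y <+> B| / #|Y|] satisfies the
    hypothesis of the previous lemma; its quotient is at most that of [X]. *)
Lemma Petridis_subset X B :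
    X != set0 ->
  exists Y, [/\ Y \subset X, Y != set0 &
    forall C, #|X| * #|Y <+> B <+> C| <= #|X <+> B| * #|Y <+> C|]%N.
Proof.
move=> X0; have X_gt0 : (0 < #|X|)%N by rewrite card_gt0.
pose P Y := (Y \subset X) && (Y != set0).
(* The quotient of #|Y <+> B| by #|Y| is compared after multiplication by #|X|`!,
   of which every #|Y| is a divisor. *)
pose q Y := (#|Y <+> B| * (#|X|`! %/ #|Y|))%N.
have PX : P X by rewrite /P subxx.
case: (arg_minnP q PX) => Y /andP[sYX Y0] minY; exists Y; split=> // C.
have qE Z : P Z -> (q Z * #|Z| = #|Z <+> B| * #|X|`!)%N.
  move=> /andP[sZX Z0]; rewrite /q -mulnA divnK //.
  by rewrite dvdn_fact // card_gt0 Z0 subset_leq_card.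
have cmp Z : P Z -> (#|Y <+> B| * #|Z| <= #|Z <+> B| * #|Y|)%N.
  move=> PZ; rewrite -(leq_pmul2r (fact_gt0 #|X|)) -!(mulnAC _ #|X|`!).
  rewrite -!qE ?/P ?sYX //.
  by rewrite mulnAC leq_mul // leq_mul // minY.
have minYY Z : Z \subset Y -> (#|Y <+> B| * #|Z| <= #|Z <+> B| * #|Y|)%N.
  move=> sZY; have [->|Z0] := eqVneq Z set0; first by rewrite cards0 muln0.
  by apply: cmp; rewrite /P (subset_trans sZY).
have le2 := Petridis C minYY.
rewrite -(@leq_pmul2l #|Y|) ?card_gt0 //.
rewrite mulnCA (leq_trans (leq_mul (leqnn _) le2)) // !mulnA leq_mul //.
by have := cmp X PX; rewrite mulnC (mulnC #|X <+> B|).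
Qed.

End Sumsets.

(** * Sets that are additively close to a set of small doubling *)

Notation "X <+> Y" := (addS X Y) (at level 50, left associativity).

Definition scaleS (F : finFieldType) (c : F) (X : {set F}) :=
  [set c * x | x in X].

Notation "c *:: X" := (scaleS c%R X) (at level 40, left associativity).

Section Scale.

Variable F : finFieldType.
Implicit Types (c d : F) (X Y : {set F}).

Lemma oppS_scale X : oppS X = -1 *:: X.
Proof. by apply: eq_imset => x; rewrite mulN1r. Qed.

Lemma scaleSD c X Y : c *:: (X <+> Y) = c *:: X <+> c *:: Y.
Proof.
apply/setP=> z; apply/imsetP/imset2P=> [[_ /imset2P[x y Xx Yy ->] ->]|].
  by exists (c * x) (c * y); rewrite ?imset_f ?mulrDr.
case=> _ _ /imsetP[x Xx ->] /imsetP[y Yy ->] ->.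
by exists (x + y); rewrite ?mulrDr ?mem_addS.
Qed.

Lemma scaleSA c d X : c *:: (d *:: X) = (c * d) *:: X.
Proof.
by rewrite /scaleS -imset_comp; apply: eq_imset => x /=; rewrite mulrA.
Qed.

Lemma scale1S X : 1 *:: X = X.
Proof.
by rewrite -[RHS]imset_id; apply: eq_imset => x; rewrite mul1r.
Qed.

Lemma scaleSB c X Y : c *:: (X <+> -1 *:: Y) = c *:: X <+> -1 *:: (c *:: Y).
Proof. by rewrite scaleSD !scaleSA mulN1r mulrN1. Qed.

Lemma scaleSS c X Y : X \subset Y -> c *:: X \subset c *:: Y.
Proof. exact: imsetS. Qed.

Lemma card_scaleS c X : c != 0 -> #|c *:: X| = #|X|.
Proof. by move=> c0; apply/card_imset/mulfI. Qed.

Lemma scaleSDl c d X : (c + d) *:: X \subset c *:: X <+> d *:: X.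
Proof.
by apply/subsetP=> _ /imsetP[x Xx ->]; rewrite mulrDl mem_addS ?imset_f.
Qed.

Lemma Ruzsa_triangle_scale X Y Z :
  (#|X| * #|Y <+> Z| <= #|Y <+> X| * #|Z <+> -1 *:: X|)%N.
Proof. by rewrite -oppS_scale; exact: Ruzsa_triangle. Qed.

End Scale.

Section SmallDoubling.

Variables (F : finFieldType) (A : {set F}) (K : nat).
Hypotheses (K_gt0 : (0 < K)%N) (A_gt0 : (0 < #|A|)%N).
Implicit Types (B C X : {set F}) (c d : F) (m n r : nat).

(** Everything is measured in powers of the doubling constant [K], so that the
    losses in the successive inequalities add up in the exponent [n]. *)
Definition close n B := (#|A <+> B| <= K ^ n * #|A|)%N.

Hypothesis closeA : close 1 A.

Lemma A_neq0 : A != set0. Proof. by rewrite -card_gt0. Qed.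

Lemma leq_closeW m n x : (m <= n)%N -> (K ^ m * x <= K ^ n * x)%N.
Proof. by move=> le_mn; rewrite leq_mul // leq_pexp2l. Qed.

Lemma closeW m n B : (m <= n)%N -> close m B -> close n B.
Proof. by move=> le_mn /leq_trans; apply; exact: leq_closeW. Qed.

Lemma closeS n B C : B \subset C -> close n C -> close n B.
Proof. by move=> sBC; apply: leq_trans; rewrite subset_leq_card ?addSS. Qed.

Lemma close1 n c : close n [set c].
Proof. by rewrite /close card_addS1 leq_pmull ?expn_gt0 ?K_gt0. Qed.

Lemma close_translate n B c : close n B -> close n (B <+> [set c]).
Proof. by rewrite /close addSA card_addS1. Qed.

(** The form of Plunnecke's inequality used below: inside [Y], adding [B] costs
    only a factor [K ^ n], whatever [C] is. *)
Lemma close_Petridis n B : close n B ->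
  exists Y : {set F}, [/\ Y \subset A, Y != set0 &
    forall C, #|Y <+> B <+> C| <= K ^ n * #|Y <+> C|]%N.
Proof.
move=> closeB; have [Y [sYA Y0 leY]] := Petridis_subset B A_neq0.
exists Y; split=> // C; rewrite -(leq_pmul2l A_gt0) (leq_trans (leY C)) //.
by rewrite mulnCA mulnA leq_mul.
Qed.

Lemma card_addS_close n B C : close n B -> (#|B <+> C| <= K ^ n * #|A <+> C|)%N.
Proof.
case/close_Petridis=> Y [sYA /set0Pn[y Yy] leY].
apply: leq_trans (leq_trans (leY C) _); last first.
  by rewrite leq_mul // subset_leq_card ?addSS.
by rewrite -addSA (addSC Y); exact: card_addSl Yy.
Qed.

Lemma close_card m n B C : close m B -> close n C ->
  (#|B <+> C| <= K ^ (m + n) * #|A|)%N.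
Proof.
move=> closeB closeC; apply: leq_trans (card_addS_close C closeB) _.
by rewrite expnD -mulnA leq_mul.
Qed.

(** [A <+> B <+> C] is [B <+> (A <+> C)], so it suffices to bound
    [A <+> A <+> C].  With a set [Y] as above for [B := A], the two copies of
    [A] are replaced by [Y], one after the other. *)
Lemma closeD m n B C : close m B -> close n C -> close (m + n + 2) (B <+> C).
Proof.
move=> closeB closeC; rewrite /close addSA (addSC A) -addSA.
apply: leq_trans (card_addS_close (A <+> C) closeB) _.
have [Y [sYA /set0Pn[y Yy] leY]] := close_Petridis closeA.
rewrite -addnA expnD -mulnA leq_mul // (@leq_trans #|Y <+> A <+> (A <+> C)|) //.
  by rewrite -(addSA Y) (addSC Y); exact: card_addSl Yy.
apply: leq_trans (leY _) _; rewrite addSA.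
apply: leq_trans (leq_mul (leqnn _) (leY _)) _.
rewrite mulnA -expnD (addnC n) (expnD K 2 n) -mulnA leq_mul //.
by apply: leq_trans closeC; rewrite subset_leq_card ?addSS.
Qed.

Lemma closeN n B : close n B -> close n.+1 (-1 *:: B).
Proof.
move=> closeB; rewrite /close -(leq_pmul2l A_gt0).
apply: leq_trans (Ruzsa_triangle_scale A A _) _.
rewrite -scaleSD card_scaleS ?oppr_eq0 ?oner_eq0 // (addSC B).
apply: leq_trans (leq_mul closeA closeB) _.
by rewrite expn1 expnS; apply: eq_leq; ring.
Qed.

(** A set is close to [A] as soon as a large part of it is: the missing part is
    within a difference of the set with that part. *)
Lemma close_enlarge m n r B X :
    (#|A| <= K ^ m * #|X|)%N -> close n X ->
    (#|B <+> -1 *:: X| <= K ^ r * #|A|)%N ->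
  close (m + n + r) B.
Proof.
move=> leX closeX leBX; rewrite /close -(leq_pmul2l A_gt0).
apply: leq_trans (leq_mul leX (leqnn _)) _.
rewrite -mulnA (leq_trans (leq_mul (leqnn _) (Ruzsa_triangle_scale _ _ _))) //.
rewrite (leq_trans (leq_mul (leqnn _) (leq_mul closeX leBX))) //.
by rewrite !expnD; apply: eq_leq; ring.
Qed.

(** The dilators of [A] behave like a subfield, except that every operation
    increases the exponent. *)
Definition dilator n c := close n (c *:: A).

Lemma dilatorW m n c : (m <= n)%N -> dilator m c -> dilator n c.
Proof. exact: closeW. Qed.

Lemma dilator0 n : dilator n 0.
Proof.
apply: closeS (close1 n 0); apply/subsetP=> _ /imsetP[x _ ->].
by rewrite mul0r set11.
Qed.

Lemma dilator1 : dilator 1 1.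
Proof. by rewrite /dilator scale1S. Qed.

Lemma dilatorD m n c d :
  dilator m c -> dilator n d -> dilator (m + n + 2) (c + d).
Proof. by move=> Dc Dd; apply: closeS (scaleSDl _ _ _) (closeD Dc Dd). Qed.

Lemma dilatorN n c : dilator n c -> dilator n.+1 (- c).
Proof. by move/closeN; rewrite scaleSA mulN1r. Qed.

Lemma dilatorV n c : dilator n c -> dilator n c^-1.
Proof.
have [->|c0] := eqVneq c 0; first by rewrite invr0.
rewrite /dilator /close -(card_scaleS (_ <+> c^-1 *:: A) c0) scaleSD scaleSA.
by rewrite mulfV // scale1S addSC.
Qed.

Lemma dilatorM m n c d :
  dilator m c -> dilator n d -> dilator (m + n + 1) (c * d).
Proof.
have [->|c0] := eqVneq c 0; first by rewrite mul0r => _ _; exact: dilator0.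
move=> Dc /closeN Dd; have -> : (m + n + 1 = 0 + m + n.+1)%N by lia.
apply: (@close_enlarge _ _ _ _ (c *:: A)) => //.
  by rewrite card_scaleS // mul1n.
have m1_neq0 : -1 != 0 :> F by rewrite oppr_eq0 oner_eq0.
rewrite -scaleSA -scaleSB card_scaleS // -(card_scaleS (_ <+> _) m1_neq0).
by rewrite scaleSD (scaleSA (-1) (-1)) mulN1r opprK scale1S addSC.
Qed.

(** A collision [a + c b = a' + c b'] with [(a, b) != (a', b')] determines [c].
    Hence on average over [c] in [S] there are at most
    [#|A| ^ 2 + #|A| ^ 4 / #|S|] collisions, whereas a small set [A <+> c *:: A]
    forces almost [#|A| ^ 3] of them. *)
Lemma dilators_average n (S : {set F}) : {in S, forall c, dilator n c} ->
  (#|S| * #|A| ^ 3 <= K ^ n * (#|S| * #|A| ^ 2 + #|A| ^ 4))%N.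
Proof.
move=> dilS; rewrite -(leq_pmul2l A_gt0).
pose Q := setX A A.
have cardQ : #|Q| = (#|A| ^ 2)%N by rewrite cardsX mulnn.
pose v c (q : F * F) := q.1 + c * q.2.
pose E c := (\sum_(q in Q) \sum_(r in Q) (v c q == v c r))%N.
apply: (@leq_trans (\sum_(c in S) #|Q| ^ 2)%N).
  by rewrite sum_nat_const cardQ; apply: eq_leq; ring.
apply: (@leq_trans (\sum_(c in S) K ^ n * #|A| * E c)%N).
  apply: leq_sum => c Sc.
  apply: leq_trans (sqr_card_collisions (v c) Q) _.
  rewrite leq_mul // (leq_trans _ (dilS c Sc)) // subset_leq_card //.
  apply/subsetP=> _ /imsetP[[a b] /setXP[Aa Ab] ->].
  by rewrite mem_addS ?imset_f.
rewrite -big_distrr /= [leqRHS]mulnA (mulnC #|A| (K ^ n)%N) leq_mul //.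
rewrite /E exchange_big /=; under eq_bigr do rewrite exchange_big /=.
apply: (@leq_trans (\sum_(q in Q) \sum_(r in Q) ((r == q) * #|S| + 1)))%N.
  apply: leq_sum => q _; apply: leq_sum => r _.
  have [->|neq] := eqVneq r q.
    rewrite mul1n (leq_trans _ (leq_addr _ _)) // -sum1_card.
    by apply: leq_sum => c _; exact: leq_b1.
  rewrite mul0n add0n; pose c0 := (q.1 - r.1) / (r.2 - q.2).
  apply: (@leq_trans (\sum_(c in S) (c == c0)))%N.
    apply: leq_sum => c _; case: eqP => // eq_qr; rewrite lt0b.
    have eq_c : c * (r.2 - q.2) = q.1 - r.1.
      by rewrite mulrBr -[q.1](addrK (c * q.2)) [q.1 + _]eq_qr /v; ring.
    have [e2|ne2] := eqVneq (r.2 - q.2) 0; last by rewrite /c0 -eq_c mulfK.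
    move: eq_c neq; rewrite e2 mulr0 => /esym/eqP.
    move/eqP: e2; rewrite !subr_eq0 => /eqP e2 /eqP e1.
    by case: (q) (r) e1 e2 => [? ?] [? ?] /= -> ->; rewrite eqxx.
  exact: sum_eq_le1.
apply: (@leq_trans (\sum_(q in Q) (#|S| + #|Q|))%N).
  apply: leq_sum => q _.
  rewrite big_split /= sum1_card leq_add2r -big_distrl /=.
  by rewrite -[leqRHS]mul1n leq_mul ?sum_eq_le1.
rewrite sum_nat_const cardQ; apply: eq_leq; ring.
Qed.

(** Field operations applied to [B] produce a set [S] of about [#|A| ^ 2]
    dilators, to which the previous lemma is applied.  The hypothesis [natF]
    says that the field is prime: the set of quotients, which contains 0, is the
    whole field as soon as it is stable under adding 1.  If it is not stable at
    [r], then [(b, b') |-> b + (r + 1) b'] is injective on [B * B], because a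
    collision would express [r + 1] as a quotient. *)
Lemma card_bound_of_dilators m n (B : {set F}) :
    (forall x : F, exists k : nat, x = k%:R) -> (#|A| ^ 2 <= #|F|)%N ->
    {in B, forall b, dilator n b} -> (#|A| <= K ^ m * #|B|)%N -> (1 < K)%N ->
  (#|A| <= K ^ (6 * n + 2 * m + 14))%N.
Proof.
move=> natF leAF dilB leAB K_gt1.
have [n' le_n' [S dilS leS]] : exists2 n', (n' <= 6 * n + 13)%N &
    exists2 S : {set F}, {in S, forall c, dilator n' c} &
                         (#|A| ^ 2 <= K ^ (2 * m) * #|S|)%N.
  pose Q := [set (b.1.1 - b.1.2) / (b.2.1 - b.2.2)
            | b in setX (setX B B) (setX B B)].
  have dilQ : {in Q, forall c, dilator (4 * n + 7) c}.
    move=> _ /imsetP[[[b1 b2] [b3 b4]]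
      /setXP[/setXP[B1 B2] /setXP[B3 B4]] ->] /=.
    have dilBB b b' : b \in B -> b' \in B -> dilator (2 * n + 3) (b - b').
      move=> Bb Bb'.
      apply: dilatorW (dilatorD (dilB _ Bb) (dilatorN (dilB _ Bb'))).
      by lia.
    apply: dilatorW (dilatorM (dilBB _ _ B1 B2) (dilatorV (dilBB _ _ B3 B4))).
    by lia.
  have B_gt0 : (0 < #|B|)%N.
    by case: #|B| leAB => //; rewrite muln0 leqNgt A_gt0.
  have [b0 Bb0] : exists b0, b0 \in B by apply/card_gt0P.
  have [QS|] := boolP [forall r in Q, r + 1 \in Q].
    exists (4 * n + 7)%N; first by lia.
    exists setT => [c _|]; last first.
      by rewrite cardsT (leq_trans leAF) // leq_pmull // expn_gt0 K_gt0.
    have [k ->] := natF c; apply: dilQ; elim: k => [|k IHk]; last first.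
      by rewrite -natr1; move/forall_inP: QS; apply.
    apply/imsetP; exists ((b0, b0), (b0, b0)); rewrite ?inE /= ?Bb0 //.
    by rewrite subrr mul0r.
  rewrite negb_forall_in => /exists_inP[r Qr nQr1].
  exists (6 * n + 13)%N => //.
  exists [set b.1 + (r + 1) * b.2 | b in setX B B].
    move=> _ /imsetP[[b1 b2] /setXP[B1 B2] ->] /=.
    have dilr := dilatorD (dilQ r Qr) dilator1.
    by apply: dilatorW (dilatorD (dilB _ B1) (dilatorM dilr (dilB _ B2))); lia.
  rewrite card_in_imset ?cardsX => [|[b1 b2] [b3 b4]].
    by rewrite (mulnC 2) expnM mulnn -expnMn leq_exp2r.
  move=> /setXP[B1 B2] /setXP[B3 B4] /= eq_b.
  have [e2|ne2] := eqVneq b2 b4; first by move: eq_b; rewrite e2 => /addIr->.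
  case/negP: nQr1; apply/imsetP; exists ((b1, b3), (b4, b2)).
    by rewrite !inE /= B1 B2 B3 B4.
  rewrite /=.
  rewrite -subr_eq0 in ne2; have ne2' : b4 - b2 != 0 by rewrite -opprB oppr_eq0.
  apply: (mulIf ne2'); rewrite mulfVK //.
  by rewrite mulrBr -[b1](addrK ((r + 1) * b2)) eq_b; ring.
have := dilators_average dilS; set N := #|A|; set s := #|S|.
move=> le1.
have A2_gt0 : (0 < N ^ 2)%N by rewrite expn_gt0 A_gt0.
have s_gt0 : (0 < s)%N.
  rewrite card_gt0; apply: contraTneq leS => ->.
  by rewrite cards0 muln0 -ltnNge.
rewrite -(leq_pmul2l A2_gt0) -(leq_pmul2l s_gt0).
have -> : (s * (N ^ 2 * N) = s * N ^ 3)%N by ring.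
apply: leq_trans le1 _.
apply: (@leq_trans (K ^ (6 * n + 13) * (s * N ^ 2 * (K ^ (2 * m) + 1)))%N).
  rewrite leq_mul ?leq_pexp2l // mulnDr muln1 addnC leq_add2r.
  rewrite (_ : N ^ 4 = N ^ 2 * N ^ 2)%N; last by ring.
  by rewrite mulnAC [leqRHS]mulnC mulnC leq_mul // mulnC.
have le2 : (K ^ (2 * m) + 1 <= K ^ (2 * m + 1))%N.
  have : (0 < K ^ (2 * m))%N by rewrite expn_gt0 K_gt0.
  rewrite (expnD K) expn1.
  by move: (K ^ (2 * m))%N => x; nia.
have -> : (6 * n + 2 * m + 14 = (6 * n + 13) + (2 * m + 1))%N by lia.
apply: leq_trans (leq_mul (leqnn _) (leq_mul (leqnn _) le2)) _.
rewrite (expnD K (6 * n + 13)); move: (K ^ (6 * n + 13))%N (K ^ (2 * m + 1))%N.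
by move=> x y; apply: eq_leq; ring.
Qed.
End SmallDoubling.

(** * Popular differences *)

Section Lines.

Variable F : finFieldType.
Implicit Types (A : {set F}) (w : F * F).

Definition line A (l m c : F) := [set s in setX A A | l * s.1 + m * s.2 == c].

Lemma lineP A l m c s : s \in line A l m c ->
  [/\ s.1 \in A, s.2 \in A & l * s.1 + m * s.2 = c].
Proof. by case: s => x y; rewrite !inE => /andP[/andP[? ?] /eqP]. Qed.

Lemma snd_line_inj A l m c : l != 0 -> {in line A l m c &, injective snd}.
Proof.
move=> l0 [x y] [x' y'] /lineP[_ _ /= e] /lineP[_ _ /= e'] eq_y.
congr pair => //; apply: (mulfI l0); apply: (addIr (m * y)).
by rewrite e -e' eq_y.
Qed.

Lemma card_line A l m c : (l != 0) || (m != 0) -> (#|line A l m c| <= #|A|)%N.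
Proof.
case/orP=> [l0|m0].
  rewrite -(card_in_imset (snd_line_inj l0)) subset_leq_card //.
  by apply/subsetP=> _ /imsetP[s /lineP[_ ? _] ->].
rewrite -(@card_in_imset _ _ fst (line A l m c)) => [|[x y] [x' y']].
  by apply/subset_leq_card/subsetP=> _ /imsetP[s /lineP[? _ _] ->].
move=> /lineP[_ _ /= e] /lineP[_ _ /= e'] /= eq_x; congr pair => //.
by apply: (mulfI m0); apply: (addrI (l * x)); rewrite e -e' eq_x.
Qed.

End Lines.

Lemma leq_mul_divn (N x P : nat) :
  (0 < P)%N -> (N %/ P < x)%N -> (N <= P * x)%N.
Proof.
move=> P_gt0 lt_x; apply: leq_trans (ltnW (ltn_ceil N P_gt0)) _.
by rewrite mulnC leq_mul.
Qed.

Section PopularDifferences.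

Variables (F : finFieldType) (A : {set F}) (K : nat).
Hypotheses (K_gt1 : (1 < K)%N) (A_gt0 : (0 < #|A|)%N) (closeA : close A K 1 A).

Let K_gt0 : (0 < K)%N. Proof. exact: ltnW. Qed.

Definition diffA := A <+> -1 *:: A.

Lemma card_diffA : (#|diffA| <= K ^ 2 * #|A|)%N.
Proof. exact: closeN. Qed.

Lemma diffA_sub x y : x \in A -> y \in A -> x - y \in diffA.
Proof. by move=> Ax Ay; rewrite -(mulN1r y) mem_addS ?imset_f. Qed.

(** The points of the line project to a large subset [X] of [A] such that
    [(m / l) *:: X] is contained in a translate of [- A]. *)
Lemma dilator_line n l m c :
    l != 0 -> m != 0 -> (#|A| <= K ^ n * #|line A l m c|)%N ->
  dilator A K (n + 4) (m / l).
Proof.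
move=> l0 m0; set L := line A l m c => leL.
pose X := [set s.2 | s in L].
have cardX : #|X| = #|L| by rewrite card_in_imset //; exact: snd_line_inj.
have sXA : X \subset A by apply/subsetP=> _ /imsetP[s /lineP[_ ? _] ->].
have ml0 : m / l != 0 by rewrite mulf_neq0 ?invr_eq0.
have closeNA := closeN A_gt0 closeA closeA.
rewrite (_ : n + 4 = n + 2 + 2)%N; last by lia.
apply: (@close_enlarge _ _ _ A_gt0 _ _ _ _ ((m / l) *:: X)).
- by rewrite card_scaleS ?cardX.
- apply: closeS (close_translate (c / l) closeNA).
  apply/subsetP=> _ /imsetP[_ /imsetP[s /lineP[A1 A2 e] ->] ->].
  rewrite (_ : m / l * s.2 = -1 * s.1 + c / l) ?mem_addS ?imset_f ?set11 //.
  by rewrite -e; field.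
rewrite -scaleSB card_scaleS //.
by apply: leq_trans closeNA; rewrite subset_leq_card // addSS // scaleSS.
Qed.

Variable phi : F -> F -> F.

(** The points from which a shift by [- w] does not change the value of [phi].
    Shifted points outside [A * A] are included, so that for a quadratic [phi]
    the level set is the whole trace of a line on [A * A]. *)
Definition level (w : F * F) :=
  [set s in setX A A | phi s.1 s.2 == phi (s.1 - w.1) (s.2 - w.2)].

Definition popular :=
  [set w in setX diffA diffA | (w != (0, 0)) && (#|A| <= K ^ 6 * #|level w|)%N].

(** There are at least [#|A| ^ 3 / K] collisions of [phi] on [A * A].  Sorted by
    their differences [w], of which there are at most [K ^ 4 * #|A| ^ 2], they
    give on average [#|A| / K ^ 5] points of [level w]; with the threshold
    [#|A| / K ^ 6] only half of the collisions can be lost.  As a level set has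
    at most [#|A|] points, about [#|A| ^ 2 / K] differences are popular. *)
Lemma card_popular :
    (#|[set phi x y | x in A, y in A]| <= K * #|A|)%N ->
    (forall w : F * F, w != (0, 0) -> (#|level w| <= #|A|)%N) ->
    (4 * K <= #|A|)%N ->
  (#|A| ^ 2 <= 4 * K * #|popular|)%N.
Proof.
move=> le_im le_level leKA.
pose Q := setX A A; pose f (s : F * F) := phi s.1 s.2.
have cardQ : #|Q| = (#|A| ^ 2)%N by rewrite cardsX mulnn.
pose Q' := [set qr in setX Q Q | (qr.1 != qr.2) && (f qr.1 == f qr.2)].
have leQ : (#|A| ^ 4 <= K * #|A| * (#|A| ^ 2 + #|Q'|))%N.
  have -> : (#|A| ^ 4 = #|Q| ^ 2)%N by rewrite cardQ -expnM.
  rewrite -cardQ.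
  apply: leq_trans (sqr_card_collisions f Q) _; apply: leq_mul.
    apply: leq_trans le_im; apply/subset_leq_card/subsetP.
    by move=> _ /imsetP[[x y] /setXP[Ax Ay] ->]; apply/imset2P; exists x y.
  apply: (@leq_trans (\sum_(q in Q)
      (1 + \sum_(r in Q | (q != r) && (f q == f r)) 1))%N).
    apply: leq_sum => q Qq; rewrite (bigD1 q) //= eqxx leq_add2l.
    rewrite [leqRHS]big_mkcondr [leqLHS]big_mkcondr /=; apply: leq_sum => r _.
    by rewrite eq_sym; case: eqP => //= _; case: eqP.
  rewrite big_split /= sum1_card leq_add2l pair_big_dep /= sum1_card.
  apply/subset_leq_card/subsetP=> -[q r].
  rewrite unfold_in /= => /and3P[Qq Qr H].
  by rewrite inE in_setX Qq Qr.
pose dif (qr : (F * F) * (F * F)) := (qr.1.1 - qr.2.1, qr.1.2 - qr.2.2).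
pose J := setX diffA diffA :\ (0, 0); pose t := (#|A| %/ K ^ 6)%N.
have le_fib w : (#|fiber dif Q' w| <= #|level w|)%N.
  have inF qr : qr \in fiber dif Q' w -> qr.1 \in level w /\
      qr.2 = (qr.1.1 - w.1, qr.1.2 - w.2).
    case: qr => -[x y] [x' y']; rewrite !inE /= => /andP[].
    move=> /andP[/andP[/andP[-> ->] _] /andP[_ fE]] /eqP <- /=.
    by rewrite !subKr fE.
  rewrite -(@card_in_imset _ _ fst (fiber dif Q' w)) => [|[q r] [q' r']].
    by apply/subset_leq_card/subsetP=> _ /imsetP[qr /inF[? _] ->].
  by move=> /inF[_ /= ->] /inF[_ /= ->] /= ->.
have QJ : {in Q', forall qr, dif qr \in J}.
  move=> [[x y] [x' y']]; rewrite !inE /=.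
  move=> /andP[/andP[/andP[Ax Ay] /andP[Ax' Ay']]].
  case/andP=> neq _; rewrite !diffA_sub // !andbT.
  by move: neq; rewrite /dif !xpair_eqE !subr_eq0.
have leM : {in J, forall w, #|fiber dif Q' w| <= #|A|}%N.
  move=> w; rewrite inE => /andP[w0 _].
  by apply: leq_trans (le_fib w) (le_level w _); rewrite inE in w0.
have leQ' := card_popular_fibers t QJ leM.
have lePi : (#|[set w in J | t < #|fiber dif Q' w|]| <= #|popular|)%N.
  apply/subset_leq_card/subsetP=> w; rewrite !inE.
  move=> /andP[/andP[-> ->] lt_t] /=.
  rewrite (leq_trans (leq_mul_divn _ lt_t)) ?expn_gt0 ?K_gt0 //.
  by rewrite leq_mul.
have leJ : (#|J| <= (K ^ 2 * #|A|) ^ 2)%N.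
  apply: leq_trans (subset_leq_card (subsetDl _ _)) _.
  by rewrite cardsX mulnn leq_exp2r // card_diffA.
have {leQ' lePi leJ} leQ' :
    (#|Q'| <= (K ^ 2 * #|A|) ^ 2 * t + #|A| * #|popular|)%N.
  by apply: leq_trans leQ' _; rewrite leq_add // leq_mul.
have tE : (t * K ^ 6 <= #|A|)%N by exact: leq_trunc_div.
move: leQ leQ' tE leKA A_gt0 K_gt1.
move: #|A| #|Q'| #|popular| t => N q b u leQ le1 tE leKA N_gt0 K2.
have le2 : (N ^ 2 <= K * N + K ^ 5 * N * u + K * b)%N.
  rewrite -(@leq_pmul2l (N ^ 2)) ?expn_gt0 ?N_gt0 //.
  apply: (@leq_trans (K * N * (N ^ 2 + ((K ^ 2 * N) ^ 2 * u + N * b)))%N).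
    rewrite -expnD; apply: leq_trans leQ _.
    by rewrite leq_mul // leq_add2l.
  by apply: eq_leq; ring.
have le3 : (K * N ^ 2 <= K ^ 2 * N + N ^ 2 + K ^ 2 * b)%N.
  apply: (@leq_trans (K * (K * N + K ^ 5 * N * u + K * b)))%N.
    by rewrite leq_mul.
  apply: (@leq_trans (K ^ 2 * N + u * K ^ 6 * N + K ^ 2 * b)%N).
    by apply: eq_leq; ring.
  by rewrite leq_add2r leq_add2l -mulnn leq_mul.
rewrite -(@leq_pmul2l K) //.
have le4 : (4 * K * (K * N) <= N * (K * N))%N by rewrite leq_mul.
have le5 : (2 * N ^ 2 <= K * N ^ 2)%N by rewrite leq_mul.
move: le3 le4 le5; rewrite -!mulnn.
nia.
Qed.

End PopularDifferences.

(** * Quadratic functions *)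

(** The form in which [card_popular_fibers] is exploited: if the small fibers
    account for at most a fraction [1 / K] of [u ^ 2] points, then [d], the
    number of large fibers, is comparable with their size [u]. *)
Lemma popular_half (K j u d : nat) :
  (1 < K -> 0 < u -> u ^ 2 <= j + u * d -> K * j <= u ^ 2 -> u <= K * d)%N.
Proof.
move=> K_gt1 u_gt0 le1 le2; rewrite -(leq_pmul2l u_gt0) mulnn.
have le3 : (2 * u ^ 2 <= K * u ^ 2)%N by rewrite leq_mul.
have le4 : (K * u ^ 2 <= K * (j + u * d))%N by rewrite leq_mul.
move: le2 le3 le4; rewrite mulnDr (mulnCA K) mul2n -addnn.
move: (u ^ 2)%N (K * j)%N (u * (K * d))%N => a b c.
by move: (K * a)%N => e; lia.
Qed.

Section Quadratic.

Variables (F : finFieldType) (A : {set F}) (K : nat).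
Hypotheses (K_gt1 : (1 < K)%N) (A_gt0 : (0 < #|A|)%N) (closeA : close A K 1 A).
Hypothesis (natF : forall x : F, exists k : nat, x = k%:R).
Hypothesis (leAF : (#|A| ^ 2 <= #|F|)%N).
Hypothesis (two_neq0 : 2%:R != 0 :> F).

Let K_gt0 : (0 < K)%N. Proof. exact: ltnW. Qed.

Let leK4 : (4 * K <= K ^ 3)%N.
Proof. by rewrite (expnSr K) leq_mul // (_ : 4 = 2 ^ 2)%N // leq_exp2r. Qed.

Section Nondegenerate.

Variables (al be ga de ep ze : F).

Definition quad (x y : F) :=
  al * x ^+ 2 + be * (x * y) + ga * y ^+ 2 + de * x + ep * y + ze.

Hypothesis det_neq0 : 4%:R * al * ga - be ^+ 2 != 0.
Hypothesis le_im : (#|[set quad x y | x in A, y in A]| <= K * #|A|)%N.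

Let l (w : F * F) := 2%:R * al * w.1 + be * w.2.
Let m (w : F * F) := be * w.1 + 2%:R * ga * w.2.
Let c (w : F * F) :=
  al * w.1 ^+ 2 + be * (w.1 * w.2) + ga * w.2 ^+ 2 - de * w.1 - ep * w.2.

Let level_line w : level A quad w = line A (l w) (m w) (c w).
Proof.
apply/setP=> -[x y]; rewrite !inE /=; congr andb.
rewrite -subr_eq0 -[RHS]subr_eq0; congr (_ == 0).
by rewrite /quad /l /m /c; ring.
Qed.

Let lm_neq0 w : w != (0, 0) -> (l w != 0) || (m w != 0).
Proof.
apply: contraNT; rewrite negb_or !negbK => /andP[/eqP l0 /eqP m0].
case: w l0 m0 => d e; rewrite /l /m /= => l0 m0.
have d0 : (4%:R * al * ga - be ^+ 2) * d = 0.
  transitivity (2%:R * ga * (2%:R * al * d + be * e) -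
                be * (be * d + 2%:R * ga * e)).
    by ring.
  by rewrite l0 m0 !mulr0 subrr.
have e0 : (4%:R * al * ga - be ^+ 2) * e = 0.
  transitivity (2%:R * al * (be * d + 2%:R * ga * e) -
                be * (2%:R * al * d + be * e)).
    by ring.
  by rewrite l0 m0 !mulr0 subrr.
move/eqP: d0; rewrite mulf_eq0 (negPf det_neq0) => /eqP->.
by move/eqP: e0; rewrite mulf_eq0 (negPf det_neq0) => /eqP->.
Qed.

(** The linear map [w |-> (l w, m w)] is invertible, so the slopes [m w / l w] of
    the popular differences take almost [#|A|] values: those [w] with a given
    slope are on a line, which meets [diffA A * diffA A] in at most
    [#|diffA A|] points. *)
Lemma nondegenerate_bound : (#|A| <= K ^ 86)%N.
Proof.
have [ltAK|leKA] := ltnP #|A| (4 * K).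
  by apply: leq_trans (ltnW ltAK) (leq_trans leK4 _); rewrite leq_pexp2l.
have le_pop : (#|A| ^ 2 <= 4 * K * #|popular A K quad|)%N.
  apply: card_popular => // w w0; rewrite level_line; apply: card_line.
  exact: lm_neq0.
pose D := diffA A.
pose L := [set m w / l w | w in popular A K quad].
have popP w : w \in popular A K quad ->
    [/\ w.1 \in D, w.2 \in D, w != (0, 0) &
        (#|A| <= K ^ 6 * #|level A quad w|)%N].
  by case: w => d e; rewrite !inE => /andP[/andP[? ?] /andP[? ?]].
have dilL : {in L, forall r, dilator A K 10 r}.
  move=> _ /imsetP[w /popP[_ _ w0 lew] ->].
  have [l0|l0] := eqVneq (l w) 0.
    by rewrite l0 invr0 mulr0; exact: dilator0.
  have [m0|m0] := eqVneq (m w) 0; first by rewrite m0 mul0r; exact: dilator0.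
  rewrite level_line in lew.
  exact: (dilator_line K_gt1 A_gt0 closeA l0 m0 lew).
have le_fib : (#|popular A K quad| <= #|L| * (2 * #|D|))%N.
  apply: (@card_le_fibers _ _ (fun w => m w / l w)).
    by move=> w pw; apply: imset_f.
  (* The differences with slope [r] lie on a line through the origin; the
     second line accounts for the convention [m w / 0 = 0]. *)
  move=> r _; pose L1 := line D (2%:R * al) be 0.
  pose L2 := line D (be - r * (2%:R * al)) (2%:R * ga - r * be) 0.
  apply: (@leq_trans #|L1 :|: L2|).
    apply/subset_leq_card/subsetP=> w.
    rewrite inE => /andP[/popP[D1 D2 w0 _] /eqP wr].
    have DD : w \in setX D D by rewrite inE D1 D2.
    rewrite inE [w \in L1]inE [w \in L2]inE DD /=.
    have [l0|l0] := eqVneq (l w) 0; first by apply/orP; left; exact/eqP.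
    apply/orP; right; apply/eqP.
    have mE : m w = r * l w by rewrite -wr mulfVK.
    transitivity (m w - r * l w); first by rewrite /l /m; ring.
    by rewrite mE subrr.
  apply: leq_trans (leq_card_setU _ _) _; rewrite mul2n -addnn leq_add //.
    apply: card_line; apply: contraNT det_neq0; rewrite negb_or !negbK.
    move=> /andP[/eqP a0 /eqP b0].
    rewrite (_ : _ - _ = 2%:R * al * (2%:R * ga) - be * be); last by ring.
    by rewrite a0 b0 !mul0r subrr.
  apply: card_line; apply: contraNT det_neq0; rewrite negb_or !negbK !subr_eq0.
  move=> /andP[/eqP a0 /eqP b0].
  apply/eqP; transitivity (2%:R * al * (2%:R * ga)); first by ring.
  by rewrite b0 mulrCA mulrA -a0.
have leD : (#|D| <= K ^ 2 * #|A|)%N by exact: card_diffA.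
have leL : (#|A| <= K ^ 6 * #|L|)%N.
  rewrite -(leq_pmul2l A_gt0) mulnn; apply: leq_trans le_pop _.
  apply: (@leq_trans (4 * K * (#|L| * (2 * (K ^ 2 * #|A|))))%N).
    by rewrite leq_mul // (leq_trans le_fib) // !leq_mul.
  apply: (@leq_trans (2 ^ 3 * K ^ 3 * (#|L| * #|A|)))%N.
    by apply: eq_leq; ring.
  rewrite [leqRHS](_ : _ = K ^ 3 * K ^ 3 * (#|L| * #|A|))%N; last by ring.
  by rewrite !leq_mul // leq_exp2r.
exact: (card_bound_of_dilators K_gt0 A_gt0 closeA natF leAF dilL leL K_gt1).
Qed.

End Nondegenerate.

Section Degenerate.

Variables (al ka de ze et : F).
Hypotheses (al0 : al != 0) (et0 : et != 0).

Definition parab (u : F) := al * u ^+ 2 + de * u + ze.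

Let al2_neq0 : 2%:R * al != 0. Proof. by rewrite mulf_neq0. Qed.

(** For a popular difference [d] of [U] there are many [u] with [u] and [u + d]
    in [U].  Dividing [parab (u + d) - parab u] by [et] gives [mu d * u] plus a
    constant, an element of [H' <+> -1 *:: H'], which is close to [A].  Hence
    [mu d] is a dilator. *)
Lemma parabola_bound (U : {set F}) (H' := et^-1 *:: [set parab u | u in U]) :
    close A K 13 U -> (#|A| <= K * #|U|)%N -> close A K 14 H' ->
  (#|A| <= K ^ 474)%N.
Proof.
move=> closeU leU closeH; have closeNU := closeN A_gt0 closeA closeU.
pose H2 := H' <+> -1 *:: H'.
have closeH2 : close A K 31 H2.
  exact (closeD A_gt0 closeA closeH (closeN A_gt0 closeA closeH)).
pose dif (s : F * F) := s.1 - s.2.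
pose UU := setX U U; pose J := U <+> -1 *:: U; pose t' := (#|A| %/ K ^ 31)%N.
pose De := [set d in J | (t' < #|fiber dif UU d|)%N].
have inUU d s : s \in fiber dif UU d ->
    [/\ s.1 \in U, s.2 \in U & s.1 = s.2 + d].
  case: s => x y; rewrite !inE /dif /= => /andP[/andP[-> ->] /eqP <-].
  by rewrite addrC subrK.
have leDe : (#|A| <= K ^ 2 * #|De|)%N.
  have leQ : (#|UU| <= #|J| * t' + #|U| * #|De|)%N.
    apply: (@card_popular_fibers _ _ dif).
      move=> [x y] /setXP[Ux Uy]; rewrite /dif /= -(mulN1r y).
      by rewrite mem_addS ?imset_f.
    move=> d _.
    apply: leq_trans (subset_leq_card _) (@card_line _ U 1 (-1) d _).
      by apply/subsetP=> -[x y]; rewrite !inE mul1r mulN1r.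
    by rewrite oner_eq0.
  have leJ : (#|J| <= K ^ 27 * #|A|)%N.
    exact (close_card A_gt0 closeU closeNU).
  have tE' : (t' * K ^ 31 <= #|A|)%N by exact: leq_trunc_div.
  have le1 : (K ^ 2 * (#|J| * t') <= #|U| ^ 2)%N.
    rewrite -(@leq_pmul2l (K ^ 2)) ?expn_gt0 ?K_gt0 // -[leqRHS]expnMn.
    apply: (@leq_trans (#|A| ^ 2)); last by rewrite leq_exp2r.
    apply: (@leq_trans (K ^ 2 * (K ^ 2 * (K ^ 27 * #|A| * t'))))%N.
      by rewrite !leq_mul.
    rewrite -mulnn; apply: (@leq_trans (#|A| * (t' * K ^ 31)))%N.
      by apply: eq_leq; ring.
    by rewrite leq_mul.
  have U_gt0 : (0 < #|U|)%N.
    by case: #|U| leU => //; rewrite muln0 leqNgt A_gt0.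
  apply: leq_trans leU _; rewrite -mulnn -mulnA leq_mul //.
  rewrite cardsX mulnn in leQ; apply: popular_half leQ _ => //.
  by apply: leq_trans le1; rewrite leq_mul // -[leqLHS]expn1 leq_exp2l.
pose mu d := 2%:R * al / et * d.
pose L := [set mu d | d in De].
have mu0 : 2%:R * al / et != 0 by rewrite mulf_neq0 ?invr_eq0.
have cardL : #|L| = #|De| by rewrite card_imset //; exact: mulfI.
have dilL : {in L, forall r, dilator A K 76 r}.
  move=> _ /imsetP[d De_d ->].
  have [d0|d0] := eqVneq d 0; first by rewrite d0 /mu mulr0; exact: dilator0.
  have mud0 : mu d != 0 by rewrite mulf_neq0.
  pose X := [set s.2 | s in fiber dif UU d].
  have cardX : #|X| = #|fiber dif UU d|.
    rewrite card_in_imset // => -[x y] [x' y'].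
    move=> /inUU[_ _ /= e] /inUU[_ _ /= e'] /= eq_y.
    by rewrite e e' eq_y.
  have sXU : X \subset U by apply/subsetP=> _ /imsetP[s /inUU[_ ? _] ->].
  apply: (@close_enlarge _ _ _ A_gt0 31 31 14 _ (mu d *:: X)).
  - rewrite card_scaleS // cardX; apply: leq_mul_divn.
      by rewrite expn_gt0 K_gt0.
    by move: De_d; rewrite inE => /andP[].
  - apply: closeS (close_translate (- ((al * d ^+ 2 + de * d) / et)) closeH2).
    apply/subsetP=> _ /imsetP[_ /imsetP[s /inUU[U1 U2 e] ->] ->].
    rewrite (_ : mu d * s.2 = (et^-1 * parab s.1 + -1 * (et^-1 * parab s.2))
      + - ((al * d ^+ 2 + de * d) / et)).
      by rewrite !mem_addS ?set11 ?imset_f.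
    by rewrite e /mu /parab; field.
  rewrite -scaleSB card_scaleS //; apply: leq_trans closeNU.
  by rewrite subset_leq_card // addSS // scaleSS.
rewrite -cardL in leDe.
exact: (card_bound_of_dilators K_gt0 A_gt0 closeA natF leAF dilL leDe K_gt1).
Qed.

Let phi (x y : F) := parab (x + ka * y) + et * y.

Hypothesis le_im : (#|[set phi x y | x in A, y in A]| <= K * #|A|)%N.

Let level_line (w : F * F) (w1 := w.1 + ka * w.2) :
  level A phi w = line A (2%:R * al * w1) (2%:R * al * w1 * ka)
                    (al * w1 ^+ 2 - de * w1 - et * w.2).
Proof.
apply/setP=> -[x y]; rewrite !inE /=; congr andb.
rewrite -subr_eq0 -[RHS]subr_eq0; congr (_ == 0).
by rewrite /phi /parab /w1; ring.
Qed.

Let level0 (w : F * F) :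
  w != (0, 0) -> w.1 + ka * w.2 = 0 -> level A phi w = set0.
Proof.
case: w => d e w0 /= w1; apply/setP=> -[x y]; rewrite level_line !inE /= w1.
apply/negP=> /andP[_].
rewrite !(mulr0, mul0r, expr0n, subr0, sub0r, oppr0, addr0) /=.
rewrite eq_sym oppr_eq0 mulf_eq0 (negPf et0) /= => /eqP e0.
by case/negP: w0; move: w1; rewrite e0 mulr0 addr0 => ->.
Qed.

(** All level lines have slope [ka]; a single popular difference suffices. *)
Let dilator_ka : (4 * K <= #|A|)%N -> dilator A K 10 ka.
Proof.
move=> leKA; have [->|ka0] := eqVneq ka 0; first exact: dilator0.
have le_pop : (#|A| ^ 2 <= 4 * K * #|popular A K phi|)%N.
  apply: card_popular => // w w0.
  have [w1|w1] := eqVneq (w.1 + ka * w.2) 0; first by rewrite level0 // cards0.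
  by rewrite level_line; apply: card_line; rewrite mulf_neq0.
have /card_gt0P[w] : (0 < #|popular A K phi|)%N.
  rewrite lt0n; apply: contraTneq le_pop => ->.
  by rewrite muln0 -ltnNge expn_gt0 A_gt0.
rewrite !inE => /andP[_ /andP[w0 lew]].
have [w1|w1] := eqVneq (w.1 + ka * w.2) 0.
  by move: lew; rewrite level0 // cards0 muln0 leqNgt A_gt0.
rewrite level_line in lew; have l0 := mulf_neq0 al2_neq0 w1.
have := dilator_line K_gt1 A_gt0 closeA l0 (mulf_neq0 l0 ka0) lew.
by rewrite mulrC mulKf.
Qed.

(** [U] is the set of popular values of [x + ka * y], and [H] its image under
    [parab].  A sum [et * y + h] with [h = parab u] in [H] can be written as
    [n + et * d] with [n] in the small set [N] and [d] in [diffA A], in as many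
    ways as there are representations [u = x' + ka * y']: take
    [n = phi x' y'] and [d = y - y'].  So [et *:: A <+> H] is small, although
    nothing is known about the sums of elements of [N]. *)
Lemma degenerate_bound : (#|A| <= K ^ 474)%N.
Proof.
have [ltAK|/dilator_ka dil_ka] := ltnP #|A| (4 * K).
  by apply: leq_trans (ltnW ltAK) (leq_trans leK4 _); rewrite leq_pexp2l.
pose f (s : F * F) := s.1 + ka * s.2.
pose Q := setX A A; pose B := A <+> ka *:: A.
pose t := (#|A| %/ K ^ 11)%N.
pose U := [set u in B | (t < #|fiber f Q u|)%N].
have cardQ : #|Q| = (#|A| ^ 2)%N by rewrite cardsX mulnn.
have closeB : close A K 13 B :=  (closeD A_gt0 closeA closeA dil_ka).
have sUB : U \subset B by apply/subsetP=> u /setIdP[].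
have closeU : close A K 13 U by exact (closeS sUB closeB).
have tE : (t * K ^ 11 <= #|A|)%N by exact: leq_trunc_div.
have ltA : (#|A| <= K ^ 11 * t.+1)%N.
  by apply: leq_mul_divn; rewrite ?expn_gt0 ?K_gt0.
have inQ u s : s \in fiber f Q u ->
    [/\ s.1 \in A, s.2 \in A & s.1 + ka * s.2 = u].
  by case: s => x y; rewrite !inE => /andP[/andP[? ?] /eqP].
have leU : (#|A| <= K * #|U|)%N.
  have leQ : (#|Q| <= #|B| * t + #|A| * #|U|)%N.
    apply: (@card_popular_fibers _ _ f).
      by move=> [x y] /setXP[Ax Ay]; rewrite mem_addS ?imset_f.
    move=> u _; apply: leq_trans (subset_leq_card _) (@card_line _ A 1 ka u _).
      by apply/subsetP=> -[x y]; rewrite !inE mul1r.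
    by rewrite oner_eq0.
  have leB : (#|B| <= K ^ 10 * #|A|)%N by exact: dil_ka.
  have le1 : (K * (#|B| * t) <= #|A| ^ 2)%N.
    apply: (@leq_trans (K * (K ^ 10 * #|A| * t)))%N; first by rewrite !leq_mul.
    rewrite -mulnn; apply: (@leq_trans (#|A| * (t * K ^ 11)))%N.
      by apply: eq_leq; ring.
    by rewrite leq_mul.
  by rewrite cardQ in leQ; exact: popular_half leQ le1.
pose N := [set phi x y | x in A, y in A].
pose D := diffA A.
have leD : (#|D| <= K ^ 2 * #|A|)%N by exact: card_diffA.
pose H := [set parab u | u in U].
have leH : (#|et *:: A <+> H| <= K ^ 14 * #|A|)%N.
  have : (#|et *:: A <+> H| * t.+1 <= #|setX N D|)%N.
    apply: (@card_ge_fibers _ _ (fun nd => nd.1 + et * nd.2)).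
    move=> _ /imset2P[_ _ /imsetP[y Ay ->] /imsetP[u Uu ->] ->].
    move: Uu; rewrite inE => /andP[_ lt_t]; apply: leq_trans lt_t _.
    pose g (s : F * F) := (phi s.1 s.2, y - s.2).
    rewrite -(@card_in_imset _ _ g (fiber f Q u)) => [|[x1 y1] [x2 y2]].
      apply/subset_leq_card/subsetP=> _ /imsetP[s /inQ[A1 A2 eu] ->].
      rewrite !inE /= diffA_sub // andbT /phi eu; apply/andP; split.
        by apply/imset2P; exists s.1 s.2; rewrite // /phi eu.
      by apply/eqP; ring.
    move=> /inQ[_ _ /= e1] /inQ[_ _ /= e2] [_ /addrI/oppr_inj ey].
    by congr pair => //; apply: (addIr (ka * y1)); rewrite e1 ey e2.
  rewrite cardsX => leZ; rewrite -(leq_pmul2r A_gt0).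
  apply: leq_trans (leq_mul (leqnn _) ltA) _.
  rewrite mulnCA; apply: leq_trans (leq_mul (leqnn _) leZ) _.
  apply: leq_trans (leq_mul (leqnn _) (leq_mul le_im leD)) _.
  by apply: eq_leq; ring.
pose H' := et^-1 *:: H.
have closeH : close A K 14 H'.
  rewrite /close -(card_scaleS (A <+> H') et0).
  by rewrite scaleSD scaleSA divff // scale1S.
exact: parabola_bound closeU leU closeH.
Qed.

End Degenerate.

End Quadratic.

(** * Bivariate polynomials of degree two *)

Module Polynomials.
Import mpoly.

Section Coefficients.
Variable F : finFieldType.
Implicit Types f : {mpoly F[2]}.
Local Notation X := ('X_ord0 : {mpoly F[2]}).
Local Notation Y := ('X_ord_max : {mpoly F[2]}).

Definition quad_mpoly (al be ga de ep ze : F) : {mpoly F[2]} :=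
  al%:MP * X ^+ 2 + be%:MP * (X * Y) + ga%:MP * Y ^+ 2 +
  de%:MP * X + ep%:MP * Y + ze%:MP.

Lemma quadratic_mpoly f : (msize f <= 3)%N ->
  exists al be ga de ep ze, f = quad_mpoly al be ga de ep ze.
Proof.
move=> le_f; pose x := U_(ord0 : 'I_2)%MM; pose y := U_(ord_max : 'I_2)%MM.
exists f@_(x *+ 2), f@_(x + y), f@_(y *+ 2), f@_x, f@_y, f@_0%MM.
apply/mpolyP=> m; rewrite /quad_mpoly -mpolyXD !mpolyXn -/x -/y.
rewrite !mcoeffD !mcoeffCM !mcoeffX mcoeffC (eq_sym m).
have key m' : f@_m' * (m' == m)%:R = f@_m * (m' == m)%:R.
  by case: eqP => [->//|_]; rewrite !mulr0.
rewrite (key (x *+ 2)%MM) (key (x + y)%MM) (key (y *+ 2)%MM).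
rewrite (key x) (key y) (key 0%MM).
rewrite -!mulrDr -!natrD.
have eq2 (m1 m2 : 'X_{1..2}) :
    (m1 == m2) = (m1 ord0 == m2 ord0) && (m1 ord_max == m2 ord_max).
  apply/eqP/andP=> [->//|[/eqP e0 /eqP e1]]; apply/mnmP=> -[[|[|//]] lt_i].
    by rewrite (_ : Ordinal _ = ord0) //; exact: val_inj.
  by rewrite (_ : Ordinal _ = ord_max) //; exact: val_inj.
have mdeg2 : mdeg m = (m ord0 + m ord_max)%N.
  by rewrite mdegE big_ord_recl big_ord1; congr (_ + m _)%N; exact: val_inj.
have f_m0 : (3 <= mdeg m)%N -> f@_m = 0.
  by move=> le_m; exact/memN_msupp_eq0/mmeasure_mnm_ge/(leq_trans le_f).
move: f_m0; rewrite mdeg2 !eq2 !mulmnE !mnmDE !mnm1E !mnm0E /=.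
move: (f@_m) (m ord0) (m ord_max) => a i j le3.
have [/le3->|] := leqP 3 (i + j); first by rewrite mul0r.
by case: i j {le3} => [|[|[|i]]] [|[|[|j]]] //= _; rewrite mulr1.
Qed.


Lemma bieval_quad_mpoly al be ga de ep ze x y :
  bieval (quad_mpoly al be ga de ep ze) x y = quad al be ga de ep ze x y.
Proof.
rewrite /bieval /quad_mpoly /quad.
by rewrite !(mevalD, mevalM, mevalC, mevalXU, rmorphXn).
Qed.

Lemma univariate_quad_mpoly al de ze a b :
  univariate_in_linear_form
    (al%:MP * (a%:MP * X + b%:MP * Y) ^+ 2 +
     de%:MP * (a%:MP * X + b%:MP * Y) + ze%:MP).
Proof.
exists (al%:P * 'X^2 + de%:P * 'X + ze%:P), a, b.
rewrite -!mul_mpolyC !rmorphD !rmorphM /= !map_polyC map_polyX /=.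
by rewrite !(hornerD, hornerM, hornerC, hornerX).
Qed.

Lemma univariate_quad_mpoly_square al ka de ze :
  univariate_in_linear_form
    (quad_mpoly al (2%:R * al * ka) (al * ka ^+ 2) de (ka * de) ze).
Proof.
have := univariate_quad_mpoly al de ze 1 ka; congr univariate_in_linear_form.
by rewrite /quad_mpoly; ring.
Qed.

Lemma univariate_quad_mpoly_Y ga ep ze :
  univariate_in_linear_form (quad_mpoly 0 0 ga 0 ep ze).
Proof.
have := univariate_quad_mpoly ga ep ze 0 1; congr univariate_in_linear_form.
by rewrite /quad_mpoly; ring.
Qed.

Lemma univariate_quad_mpoly_affine de ep ze :
  univariate_in_linear_form (quad_mpoly 0 0 0 de ep ze).
Proof.
have := univariate_quad_mpoly 0 1 ze de ep; congr univariate_in_linear_form.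
by rewrite /quad_mpoly; ring.
Qed.

End Coefficients.
End Polynomials.

(** * Growth *)

Import Polynomials.

(** If the discriminant vanishes, completing the square brings [f] to the form
    [parab (x + ka * y) + et * y] when the coefficient of [x ^ 2] is nonzero, and
    to the same form with [x] and [y] exchanged and [ka = 0] otherwise.  In each
    case [et = 0] would make [f] a polynomial in one linear form; an affine [f]
    is one too, so the quadratic part does not vanish. *)
Lemma small_images_bound (F : finFieldType) (A : {set F}) (K : nat)
    (f : bipoly F) :
    (forall x : F, exists k : nat, x = k%:R) -> 2%:R != 0 :> F ->
    (#|A| ^ 2 <= #|F|)%N -> (0 < #|A|)%N -> (1 < K)%N ->
    quadratic f -> ~ univariate_in_linear_form f ->
    (#|sumset A| <= K * #|A|)%N -> (#|poly_image f A| <= K * #|A|)%N ->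
  (#|A| <= K ^ 474)%N.
Proof.
move=> natF two0 leAF A_gt0 K_gt1 f2 f_nonuniv leS le_im.
have closeA : close A K 1 A by rewrite /close expn1.
have [|al [be [ga [de [ep [ze fE]]]]]] := @quadratic_mpoly F f.
  by rewrite f2.
have imE : poly_image f A = [set quad al be ga de ep ze x y | x in A, y in A].
  by apply: eq_in_imset2 => x y _ _; rewrite fE bieval_quad_mpoly.
have [det0|] := eqVneq (4%:R * al * ga - be ^+ 2) 0; last first.
  move=> det; rewrite imE in le_im.
  have := nondegenerate_bound K_gt1 A_gt0 closeA natF leAF det le_im.
  move/leq_trans; apply.
  by rewrite leq_pexp2l // ltnW.
have degenerate := degenerate_bound K_gt1 A_gt0 closeA natF leAF two0.
have [al0|al0] := eqVneq al 0; last first.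
  pose ka := be / (2%:R * al).
  have al2 : 2%:R * al != 0 by rewrite mulf_neq0.
  have beE : be = 2%:R * al * ka by rewrite mulrC mulfVK.
  have gaE : ga = al * ka ^+ 2.
    have four_al : 4%:R * al != 0.
      by rewrite (_ : 4%:R = 2%:R * 2%:R) ?mulf_neq0 // -natrM.
    apply: (mulfI four_al); apply/eqP; rewrite -subr_eq0 -det0 beE.
    by apply/eqP; ring.
  have et0 : ep - ka * de != 0.
    rewrite subr_eq0; apply/eqP=> epE; apply: f_nonuniv; rewrite fE beE gaE epE.
    exact: univariate_quad_mpoly_square.
  apply: (degenerate al ka de ze _ al0 et0).
  rewrite (_ : imset2 _ _ _ = poly_image f A) // imE.
  by apply: eq_in_imset2 => x y _ _; rewrite /quad /parab beE gaE; ring.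
move: det0; rewrite al0 mulr0 mul0r sub0r => /eqP.
rewrite oppr_eq0 expf_eq0 /= => /eqP be0.
have ga0 : ga != 0.
  apply/eqP=> ga0; apply: f_nonuniv; rewrite fE al0 be0 ga0.
  exact: univariate_quad_mpoly_affine.
have de0 : de != 0.
  apply/eqP=> de0; apply: f_nonuniv; rewrite fE al0 be0 de0.
  exact: univariate_quad_mpoly_Y.
apply: (degenerate ga 0 ep ze _ ga0 de0).
rewrite (_ : imset2 _ _ _ = poly_image f A) // imE.
apply/setP=> z; apply/imset2P/imset2P=> -[x y Ax Ay ->]; exists y x => //;
  by rewrite /quad /parab al0 be0; ring.
Qed.

(** The best integer [K] with [s <= K * n] is at most [2 * s / n]; taking [e]-th
    roots in [n <= K ^ e] gives the claim. *)
Lemma powR_le_of_pow (R : realType) (n s e : nat) : (0 < e)%N -> (0 < n)%N ->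
    (forall K, (1 < K)%N -> (s <= K * n)%N -> (n <= K ^ e)%N) -> (n < s)%N ->
  2^-1 * (n%:R `^ (1 + e%:R^-1)) <= s%:R :> R.
Proof.
move=> e_gt0 n_gt0 bound lt_ns.
pose K := (s %/ n).+1.
have K_gt1 : (1 < K)%N by rewrite ltnS divn_gt0 // ltnW.
have sK : (s <= K * n)%N by rewrite ltnW // ltn_ceil.
have Ks : (K * n <= 2 * s)%N.
  by rewrite mul2n -addnn mulSn leq_add ?(ltnW lt_ns) // leq_trunc_div.
have nK := bound K K_gt1 sK.
have e0 : e%:R != 0 :> R by rewrite pnatr_eq0 -lt0n.
have powK : n%:R `^ (e%:R^-1) <= K%:R :> R.
  have -> : K%:R = (K%:R ^+ e) `^ (e%:R^-1) :> R.
    by rewrite -powR_mulrn // -powRrM mulfV // powRr1.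
  apply: ge0_ler_powR; rewrite ?invr_ge0 ?nnegrE ?exprn_ge0 //.
  by rewrite -natrX ler_nat.
rewrite powRD ?powRr1 //; last by rewrite pnatr_eq0 -lt0n n_gt0 implybT.
rewrite mulrC ler_pdivrMr // -natrM mulnC.
apply: Order.POrderTheory.le_trans (_ : K%:R * n%:R <= _).
  by rewrite mulrC ler_wpM2r.
by rewrite -natrM ler_nat.
Qed.

Theorem theorem2 (R : realType) :
  exists c C : R, [/\ 0 < c, 0 < C &
    forall (p : nat) (f : bipoly 'F_p),
      prime p -> quadratic f -> ~ univariate_in_linear_form f ->
      forall A : {set 'F_p},
        (#|A|%:R : R) <= Num.sqrt p%:R ->
        C * (#|A|%:R `^ (1 + c)) <= (#|sumset A| + #|poly_image f A|)%N%:R].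
Proof.
exists 474%:R^-1, 2^-1; split; rewrite ?invr_gt0 ?ltr0n //.
move=> p f p_pr f2 f_nonuniv A leA.
have [->|/set0Pn[a Aa]] := eqVneq A set0.
  rewrite cards0 powR0 ?mulr0 ?ler0n // lt0r_neq0 //.
  by rewrite addr_gt0 ?invr_gt0 ?ltr0n.
have A_gt0 : (0 < #|A|)%N by apply/card_gt0P; exists a.
have le_AS : (#|A| <= #|sumset A|)%N by exact: card_addSl Aa.
have im_gt0 : (0 < #|poly_image f A|)%N.
  by apply/card_gt0P; exists (bieval f a a); apply/imset2P; exists a a.
have leAp : (#|A| ^ 2 <= p)%N.
  have := leA; rewrite -(ler_sqr (ler0n _ _)) ?nnegrE ?sqrtr_ge0 //.
  by rewrite sqr_sqrtr ?ler0n // -natrX ler_nat.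
apply: powR_le_of_pow => // [K K_gt1 leK|]; last first.
  by rewrite -addn1 leq_add.
have [A_le1|A_gt1] := leqP #|A| 1.
  by apply: leq_trans A_le1 _; rewrite expn_gt0 ltnW.
apply: (@small_images_bound _ A K f) => //.
- by move=> x; exists x; rewrite natr_Zp.
- have p_gt2 : (2 < p)%N.
    by apply: leq_trans leAp; rewrite (@leq_trans (2 ^ 2)) // leq_exp2r.
  rewrite -(dvdn_pcharf (pchar_Fp p_pr)).
  by apply: contraL p_gt2 => /dvdn_leq; rewrite -leqNgt; apply.
- by rewrite card_Fp.
- by apply: leq_trans leK; rewrite leq_addr.
by apply: leq_trans leK; rewrite leq_addl.
Qed.
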